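(* If $F:(A,\mu,\alpha,D)\to(B,\nu,\beta,E)$ is a morphism in $\mathbf{HomAsDer}_\alpha$, then $F$ is also a morphism $(A,[\cdot,\cdot]_A,\alpha,D)\to(B,[\cdot,\cdot]_B,\beta,E)$ in $\mathbf{HomLieDer}_\alpha$, where $[a,b]_A:=\mu(a,b)-\mu(b,a)$ for $a,b\in A$ and $[a,b]_B:=\nu(a,b)-\nu(b,a)$ for $a,b\in B$.
   Context: All vector spaces are over a fixed field $\mathbb{K}$ of characteristic $0$. A Hom-Lie algebra is a triple $(\mathfrak g,[\cdot,\cdot],\alpha)$ with $\mathfrak g$ a vector space, $[\cdot,\cdot]$ a skew-symmetric bilinear map on $\mathfrak g$ and $\alpha:\mathfrak g\to\mathfrak g$ linear such that $[\alpha(x),[y,z]]+[\alpha(y),[z,x]]+[\alpha(z),[x,y]]=0$ and $\alpha([x,y])=[\alpha(x),\alpha(y)]$ for all $x,y,z$. An $\alpha$-derivation of it is a linear map $d:\mathfrak g\to\mathfrak g$ with $d\circ\alpha=\alpha\circ d$ and $d([x,y])=[d(x),\alpha(y)]+[\alpha(x),d(y)]$. A Hom-associative algebra (not assumed unital) is a triple $(A,\mu,\alpha)$ with $\mu:A\times A\to A$ bilinear, written $\mu(a,b)=ab$, and $\alpha:A\to A$ linear such that $\alpha(ab)=\alpha(a)\alpha(b)$ and $\alpha(a)(bc)=(ab)\alpha(c)$ for all $a,b,c$. An $\alpha$-derivation of it is a linear map $D:A\to A$ with $D\circ\alpha=\alpha\circ D$ and $D(ab)=D(a)\alpha(b)+\alpha(a)D(b)$.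 $\mathbf{HomLieDer}_\alpha$: objects are Hom-Lie algebras with an $\alpha$-derivation $(\mathfrak g,[\cdot,\cdot],\alpha,d)$; a morphism $f:(\mathfrak g,[\cdot,\cdot],\alpha,d)\to(\mathfrak h,[\cdot,\cdot]_{\mathfrak h},\beta,\delta)$ is a linear map with $f([x,y])=[f(x),f(y)]_{\mathfrak h}$, $f\circ\alpha=\beta\circ f$, $f\circ d=\delta\circ f$. $\mathbf{HomAsDer}_\alpha$: objects are Hom-associative algebras with an $\alpha$-derivation $(A,\mu,\alpha,D)$; a morphism $F:(A,\mu,\alpha,D)\to(B,\nu,\beta,E)$ is a linear map with $F(\mu(a,b))=\nu(F(a),F(b))$, $F\circ\alpha=\beta\circ F$, $F\circ D=E\circ F$. The twisting map varies with the object. For an object $(A,\mu,\alpha,D)$ of $\mathbf{HomAsDer}_\alpha$, the quadruple $(A,[\cdot,\cdot]_A,\alpha,D)$ is an object of $\mathbf{HomLieDer}_\alpha$. *)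

(* Defs.v *)
From HB Require Import structures.
From mathcomp Require Import all_boot all_algebra.

Set Implicit Arguments.
Unset Strict Implicit.
Unset Printing Implicit Defensive.

Import GRing.Theory.
Local Open Scope ring_scope.

Record is_hom_lie (K : fieldType) (g : lmodType K)
    (br : {bilinear g -> g -> g}) (alpha : {linear g -> g}) : Prop := IsHomLie {
  hom_lie_skew : forall x y, br x y = - br y x;
  hom_lie_jacobi : forall x y z,
    br (alpha x) (br y z) + br (alpha y) (br z x) + br (alpha z) (br x y) = 0;
  hom_lie_mult : forall x y, alpha (br x y) = br (alpha x) (alpha y) }.

Record is_hom_assoc (K : fieldType) (A : lmodType K)
    (mu : {bilinear A -> A -> A}) (alpha : {linear A -> A}) : Prop := IsHomAssoc {
  hom_assoc_mult : forall a b, alpha (mu a b) = mu (alpha a) (alpha b);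
  hom_assoc_assoc : forall a b c, mu (alpha a) (mu b c) = mu (mu a b) (alpha c) }.

(* The defining identities of an alpha-derivation have the same shape for a
   Hom-Lie bracket and for a Hom-associative product. *)
Record is_alpha_derivation (K : fieldType) (V : lmodType K)
    (m : {bilinear V -> V -> V}) (alpha d : {linear V -> V}) : Prop :=
  IsAlphaDerivation {
  alpha_der_comm : forall x, d (alpha x) = alpha (d x);
  alpha_der_leibniz : forall x y, d (m x y) = m (d x) (alpha y) + m (alpha x) (d y) }.

Record homLieDer (K : fieldType) := HomLieDer {
  hld_sort :> lmodType K;
  hld_bracket : {bilinear hld_sort -> hld_sort -> hld_sort};
  hld_twist : {linear hld_sort -> hld_sort};
  hld_der : {linear hld_sort -> hld_sort};
  hld_hom_lie : is_hom_lie hld_bracket hld_twist;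
  hld_derivation : is_alpha_derivation hld_bracket hld_twist hld_der }.

Record homAsDer (K : fieldType) := HomAsDer {
  had_sort :> lmodType K;
  had_mul : {bilinear had_sort -> had_sort -> had_sort};
  had_twist : {linear had_sort -> had_sort};
  had_der : {linear had_sort -> had_sort};
  had_hom_assoc : is_hom_assoc had_mul had_twist;
  had_derivation : is_alpha_derivation had_mul had_twist had_der }.

Record homLieDer_morphism (K : fieldType) (g h : homLieDer K)
    (f : {linear g -> h}) : Prop := HomLieDerMorphism {
  hld_morph_bracket : forall x y,
    f (hld_bracket g x y) = hld_bracket h (f x) (f y);
  hld_morph_twist : forall x, f (hld_twist g x) = hld_twist h (f x);
  hld_morph_der : forall x, f (hld_der g x) = hld_der h (f x) }.

Record homAsDer_morphism (K : fieldType) (A B : homAsDer K)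
    (F : {linear A -> B}) : Prop := HomAsDerMorphism {
  had_morph_mul : forall a b, F (had_mul A a b) = had_mul B (F a) (F b);
  had_morph_twist : forall a, F (had_twist A a) = had_twist B (F a);
  had_morph_der : forall a, F (had_der A a) = had_der B (F a) }.

Arguments homLieDer_morphism {K} g h f.
Arguments homAsDer_morphism {K} A B F.

Definition commutator (K : fieldType) (A : lmodType K)
  (mu : {bilinear A -> A -> A}) (a b : A) : A := mu a b - mu b a.

Lemma zmod_jacobi_sum (V : zmodType) (a b c a' b' c' : V) :
  (a - a') - (b - c') + ((b - b') - (c - a')) + ((c - c') - (a - b')) = 0.
Proof.
have E (u v w t : V) : (u - v) - (w - t) = (u - w) - (v - t).
  by rewrite opprD addrACA -opprD.
rewrite (E a) (E b) (E c) [X in X + _]addrACA -opprD addrACA -opprD.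
by rewrite [(a' - c') + _]addrC !subrKA !subrr.
Qed.

Section Commutator.
Variables (K : fieldType) (A : lmodType K) (mu : {bilinear A -> A -> A}).

Lemma commutator_is_bilinear :
  bilinear_for ( *:%R : K -> A -> A) ( *:%R : K -> A -> A) (commutator mu).
Proof.
split=> b k x y; rewrite /= /commutator linearPl linearPr /=;
  by rewrite opprD addrACA -scalerN -scalerDr.
Qed.

HB.instance Definition _ :=
  bilinear_isBilinear.Build K A A A *:%R *:%R (commutator mu)
    commutator_is_bilinear.

Lemma commutator_hom_lie (alpha : {linear A -> A}) :
  is_hom_assoc mu alpha -> is_hom_lie (commutator mu) alpha.
Proof.
case=> multA assocA; split=> [x y|x y z|x y].
- by rewrite /= /commutator opprB.
- rewrite /= /commutator !linearBl !linearBr /= !assocA.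
  exact: zmod_jacobi_sum.
- by rewrite /= /commutator linearB !multA.
Qed.

Lemma commutator_derivation (alpha d : {linear A -> A}) :
  is_alpha_derivation mu alpha d -> is_alpha_derivation (commutator mu) alpha d.
Proof.
case=> comm_d leib; split=> // x y.
rewrite /= /commutator linearB !leib.
by rewrite [X in _ - X]addrC opprD addrACA.
Qed.

End Commutator.

(* (A, [a, b] = ab - ba, alpha, D): carrier, twist and derivation are those of A
   by conversion, so a linear map between A and B is one between the images. *)
Definition homLieDer_of_homAsDer (K : fieldType) (A : homAsDer K) : homLieDer K :=
  HomLieDer (commutator_hom_lie (had_hom_assoc A))
            (commutator_derivation (had_derivation A)).

(* Main.v *)
Require Import Defs.
From mathcomp Require Import all_boot all_algebra.
Import GRing.Theory.
Local Open Scope ring_scope.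

Theorem proposition2p20 (K : fieldType) (charK : [pchar K] =i pred0)
    (A B : homAsDer K) (F : {linear A -> B}) :
  homAsDer_morphism A B F ->
  homLieDer_morphism (homLieDer_of_homAsDer A) (homLieDer_of_homAsDer B) F.
Proof.
(* Passing to the commutator keeps carrier, twist and derivation, so the conditions on these are
   [twistF] and [derF] up to conversion. Only the bracket is left. *)
case=> mulF twistF derF; split=> //= x y.
(* The bracket is a difference of two products: additivity of [F] splits the difference, and [mulF]
   carries each product, in either order of the factors, to [B]. *)
by rewrite /commutator linearB !mulF.
Qed.
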